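(* Let $T:V\to L$ be an $\mathcal{O}$-operator on a L.t.sRep pair $(L,[\cdot,\cdot,\cdot];\theta)$, with $\theta$ a representation on $V$. If $Z_T^1(V,L)=d_T(\mathrm{Nij}(T))$, then $T$ is rigid.
   Context: All vector spaces are over a field $\mathbb{K}$ of characteristic $0$. A Lie triple system (L.t.s) is a vector space $L$ with a trilinear bracket $[\cdot,\cdot,\cdot]:\wedge^2L\otimes L\to L$ (skew-symmetric in the first two arguments) such that for all $x,y,z,t,e\in L$: $[x,y,z]+[y,z,x]+[z,x,y]=0$ and $[x,y,[z,t,e]]=[[x,y,z],t,e]+[z,[x,y,t],e]+[z,t,[x,y,e]]$. A morphism of L.t.s is a linear map preserving the ternary brackets. A representation of $L$ on a vector space $V$ is a bilinear map $\theta:\otimes^2L\to End(V)$ such that, with $D(x,y)=\theta(y,x)-\theta(x,y)$, for all $x,y,z,t\in L$: $\theta(z,t)\theta(x,y)-\theta(y,t)\theta(x,z)-\theta(x,[y,z,t])+D(y,z)\theta(x,t)=0$ and $\theta(z,t)D(x,y)-D(x,y)\theta(z,t)+\theta([x,y,z],t)+\theta(z,[x,y,t])=0$. A L.t.s together with a representation is called a L.t.sRep pair $(L,[\cdot,\cdot,\cdot];\theta)$. For $\mathfrak{X}=x\wedge y\in L\wedge L$ write $D(\mathfrak{X})=D(x,y)$, $[\mathfrak{X},z]=[x,y,z]$, extended linearly. A linear map $T:V\to L$ is an $\mathcal{O}$-operator on the pair if $[Tu,Tv,Tw]=T\big(D(Tu,Tv)w+\theta(Tv,Tw)u-\theta(Tu,Tw)v\big)$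 for all $u,v,w\in V$. Then $V$ is a L.t.s under $[u,v,w]_T=D(Tu,Tv)w+\theta(Tv,Tw)u-\theta(Tu,Tw)v$, and $\theta_T(u,v)x=[x,Tu,Tv]+T\big(\theta(x,Tv)u-D(x,Tu)v\big)$ is a representation of it on $L$; put $D_T(u,v)=\theta_T(v,u)-\theta_T(u,v)$. A morphism from an $\mathcal{O}$-operator $T$ to an $\mathcal{O}$-operator $T'$ on the same pair is a pair $(\phi,\psi)$ of a L.t.s morphism $\phi:L\to L$ and a linear map $\psi:V\to V$ with $\phi\circ T=T'\circ\psi$ and $\psi\,\theta(x,y)=\theta(\phi(x),\phi(y))\,\psi$ for all $x,y\in L$. $Z_T^1(V,L)$ is the space of linear maps $f:V\to L$ with $D_T(v_1,v_2)f(v_3)-\theta_T(v_1,v_3)f(v_2)+\theta_T(v_2,v_3)f(v_1)-f([v_1,v_2,v_3]_T)=0$ for all $v_i\in V$. For $\mathfrak{X}\in L\wedge L$, $d_T(\mathfrak{X}):V\to L$ is $d_T(\mathfrak{X})(v)=TD(\mathfrak{X})v-[\mathfrak{X},Tv]$. $\mathrm{Nij}(T)$ is the set of Nijenhuis elements associated to $T$: those $\mathfrak{X}\in L\wedge L$ such that for all $z_1,z_2,z_3\in L$ and $u\in V$: (1) $[z_1,[\mathfrak{X},z_2],[\mathfrak{X},z_3]]+[[\mathfrak{X},z_1],z_2,[\mathfrak{X},z_3]]+[[\mathfrak{X},z_1],[\mathfrak{X},z_2],z_3]=0$ and $[[\mathfrak{X},z_1],[\mathfrak{X},z_2],[\mathfrak{X},z_3]]=0$;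 (2) $\theta(z_1,[\mathfrak{X},z_2])D(\mathfrak{X})+\theta([\mathfrak{X},z_1],z_2)D(\mathfrak{X})+\theta([\mathfrak{X},z_1],[\mathfrak{X},z_2])=0$ and $\theta([\mathfrak{X},z_1],[\mathfrak{X},z_2])D(\mathfrak{X})=0$; (3) $[\mathfrak{X},TD(\mathfrak{X})(u)-[\mathfrak{X},T(u)]]=0$. The bracket of $L$ and $\theta$, $D$ are extended $\mathbb{K}[[t]]$-multilinearly (coefficientwise, by Cauchy product) to $L[[t]]$, $V[[t]]$. A formal deformation of $T$ is a power series $T_t=\sum_{i\ge0}T_it^i$ with $T_i\in Hom_{\mathbb{K}}(V,L)$, $T_0=T$, satisfying $[T_t(u),T_t(v),T_t(w)]=T_t\big(D(T_t(u),T_t(v))w+\theta(T_t(v),T_t(w))u-\theta(T_t(u),T_t(w))v\big)$ for all $u,v,w\in V$. Two formal deformations $T_t$, $T'_t$ of $T$ are equivalent if there exist $\mathfrak{X}\in L\wedge L$, $\phi_i\in gl(L)$, $\psi_i\in gl(V)$ ($i\ge2$) such that $\big(\phi_t=Id_L+t[\mathfrak{X},-]+\sum_{i\ge2}\phi_it^i,\ \psi_t=Id_V+tD(\mathfrak{X})(-)+\sum_{i\ge2}\psi_it^i\big)$ is a morphism of $\mathcal{O}$-operators (over $\mathbb{K}[[t]]$) from $T_t$ to $T'_t$. A formal deformation $T_t$ is trivial if it is equivalent to $T$ (regarded as a deformation of itself). $T$ is rigid if every formal deformation $T_t$ of $T$ is trivial. *)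

(* Defs.v *)
From HB Require Import structures.
From mathcomp Require Import all_boot all_order all_algebra.
From mathcomp Require Import boolp classical_sets functions.

Set Implicit Arguments.
Unset Strict Implicit.
Unset Printing Implicit Defensive.

Import GRing.Theory.
Local Open Scope ring_scope.
Local Open Scope quotient_scope.

(* The exterior square [ext2 L] of a possibly infinite-dimensional space.  A   *)
(* sequence [:: (x1, y1); ..; (xn, yn)] stands for x1 /\ y1 + .. + xn /\ yn,   *)
(* and two sequences are identified when no alternating bilinear map with      *)
(* values in a K-module separates them; this is the congruence generated by    *)
(* the defining relations of the exterior square.                              *)
Section ExteriorSquare.
Variables (K : fieldType) (L : lmodType K).

Definition alternating_bilinear (W : lmodType K) (B : L -> L -> W) : Prop :=
  [/\ forall y, linear (B^~ y), forall x, linear (B x) & forall x, B x x = 0].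

Definition eval_pairs (W : lmodType K) (B : L -> L -> W) (s : seq (L * L)) : W :=
  \sum_(p <- s) B p.1 p.2.

Definition same_pairs (s s' : seq (L * L)) : Prop :=
  forall (W : lmodType K) (B : L -> L -> W),
    alternating_bilinear B -> eval_pairs B s = eval_pairs B s'.

Definition same_pairsb : rel (seq (L * L)) := fun s s' => `[< same_pairs s s' >].

Lemma same_pairs_refl : reflexive same_pairsb.
Proof. by move=> s; apply/asboolP. Qed.

Lemma same_pairs_sym : symmetric same_pairsb.
Proof.
by move=> s s'; apply/asboolP/asboolP => h W B hB; rewrite h.
Qed.

Lemma same_pairs_trans : transitive same_pairsb.
Proof.
move=> s s1 s2 /asboolP h1 /asboolP h2; apply/asboolP => W B hB.
by rewrite h1 // h2.
Qed.

Canonical same_pairs_equiv :=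
  EquivRel same_pairsb same_pairs_refl same_pairs_sym same_pairs_trans.

Definition ext2 : Type := {eq_quot same_pairsb}.
HB.instance Definition _ := Choice.on ext2.
HB.instance Definition _ := EqQuotient.on ext2.

Definition wedge (x y : L) : ext2 := \pi_ext2 [:: (x, y)].

(* Value at X of the linear map ext2 L -> W induced by B; see [ext2_lift_wedge] *)
(* and [ext2_lift_linear] when B is alternating bilinear.                       *)
Definition ext2_lift (W : lmodType K) (B : L -> L -> W) (X : ext2) : W :=
  eval_pairs B (repr X).

Lemma ext2_lift_pi (W : lmodType K) (B : L -> L -> W) s :
  alternating_bilinear B -> ext2_lift B (\pi_ext2 s) = eval_pairs B s.
Proof.
move=> hB; have /eqmodP/asboolP h : repr (\pi_ext2 s) = s %[mod ext2].
  by rewrite reprK.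
exact: h.
Qed.

Lemma ext2_ext (X Y : ext2) :
  (forall (W : lmodType K) (B : L -> L -> W),
     alternating_bilinear B -> ext2_lift B X = ext2_lift B Y) -> X = Y.
Proof.
by move=> h; rewrite -[X]reprK -[Y]reprK; apply/eqmodP/asboolP => W B /h.
Qed.

Definition ext2_zero : ext2 := \pi_ext2 [::].
Definition ext2_add (X Y : ext2) : ext2 := \pi_ext2 (repr X ++ repr Y).
Definition ext2_scale (a : K) (X : ext2) : ext2 :=
  \pi_ext2 [seq (a *: p.1, p.2) | p <- repr X].
Definition ext2_opp (X : ext2) : ext2 := ext2_scale (-1) X.

Section LiftOperations.
Variables (W : lmodType K) (B : L -> L -> W).
Hypothesis hB : alternating_bilinear B.

Lemma alternating_scalel a x y : B (a *: x) y = a *: B x y.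
Proof.
case: hB => hl _ _; have h0 : B 0 y = 0.
  by have := hl y (-1) 0 0; rewrite scaler0 addr0 scaleN1r addNr.
by have := hl y a x 0; rewrite h0 !addr0.
Qed.

Lemma ext2_lift0 : ext2_lift B ext2_zero = 0.
Proof. by rewrite ext2_lift_pi // /eval_pairs big_nil. Qed.

Lemma ext2_liftD X Y :
  ext2_lift B (ext2_add X Y) = ext2_lift B X + ext2_lift B Y.
Proof. by rewrite ext2_lift_pi // /eval_pairs big_cat. Qed.

Lemma ext2_liftZ a X : ext2_lift B (ext2_scale a X) = a *: ext2_lift B X.
Proof.
rewrite ext2_lift_pi // /eval_pairs big_map scaler_sumr.
by apply: eq_bigr => p _; rewrite alternating_scalel.
Qed.
End LiftOperations.

Fact ext2_addA : associative ext2_add.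
Proof.
by move=> X Y Z; apply: ext2_ext => W B hB; rewrite !ext2_liftD // addrA.
Qed.

Fact ext2_addC : commutative ext2_add.
Proof.
by move=> X Y; apply: ext2_ext => W B hB; rewrite !ext2_liftD // addrC.
Qed.

Fact ext2_add0 : left_id ext2_zero ext2_add.
Proof.
by move=> X; apply: ext2_ext => W B hB; rewrite ext2_liftD // ext2_lift0 // add0r.
Qed.

Fact ext2_addN : left_inverse ext2_zero ext2_opp ext2_add.
Proof.
move=> X; apply: ext2_ext => W B hB.
by rewrite ext2_liftD // ext2_liftZ // ext2_lift0 // scaleN1r addNr.
Qed.

HB.instance Definition _ :=
  GRing.isZmodule.Build ext2 ext2_addA ext2_addC ext2_add0 ext2_addN.

Fact ext2_scaleA a b X : ext2_scale a (ext2_scale b X) = ext2_scale (a * b) X.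
Proof.
by apply: ext2_ext => W B hB; rewrite !ext2_liftZ // scalerA.
Qed.

Fact ext2_scale1 : left_id 1 ext2_scale.
Proof. by move=> X; apply: ext2_ext => W B hB; rewrite ext2_liftZ // scale1r. Qed.

Fact ext2_scaleDr : right_distributive ext2_scale +%R.
Proof.
move=> a X Y; apply: ext2_ext => W B hB.
by rewrite ext2_liftZ // !ext2_liftD // !ext2_liftZ // scalerDr.
Qed.

Fact ext2_scaleDl X : {morph ext2_scale^~ X : a b / a + b}.
Proof.
move=> a b; apply: ext2_ext => W B hB.
by rewrite ext2_liftD // !ext2_liftZ // scalerDl.
Qed.

HB.instance Definition _ := GRing.Zmodule_isLmodule.Build K ext2
  ext2_scaleA ext2_scale1 ext2_scaleDr ext2_scaleDl.

Lemma ext2_lift_linear (W : lmodType K) (B : L -> L -> W) :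
  alternating_bilinear B -> linear (ext2_lift B).
Proof. by move=> hB a X Y; rewrite ext2_liftD // ext2_liftZ. Qed.

Lemma ext2_lift_wedge (W : lmodType K) (B : L -> L -> W) x y :
  alternating_bilinear B -> ext2_lift B (wedge x y) = B x y.
Proof. by move=> hB; rewrite ext2_lift_pi // /eval_pairs big_seq1. Qed.

Lemma wedge_alternating : alternating_bilinear wedge.
Proof.
split=> [y a x x' | x a y y' | x]; apply: ext2_ext => W B hB;
  rewrite ?(ext2_lift_linear hB) ?ext2_lift0 ?ext2_lift_wedge //;
  by case: hB => hl hr h0; rewrite ?hl ?hr ?h0.
Qed.

Lemma ext2_wedge_sum (X : ext2) : exists s : seq (L * L),
  X = \sum_(p <- s) wedge p.1 p.2.
Proof.
exists (repr X); rewrite -{1}[X]reprK.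
elim: (repr X) => [|p s IHs]; first by rewrite big_nil.
rewrite big_cons -IHs; apply: ext2_ext => W B hB.
rewrite ext2_liftD // ext2_lift_wedge // !ext2_lift_pi //.
by rewrite /eval_pairs big_cons.
Qed.
End ExteriorSquare.

Section LieTripleSystems.
Variables (K : fieldType) (L : lmodType K).

Record lts := Lts {
  lts_bracket :> L -> L -> L -> L;
  lts_linear1 : forall y z, linear (fun x => lts_bracket x y z);
  lts_linear2 : forall x z, linear (fun y => lts_bracket x y z);
  lts_linear3 : forall x y, linear (lts_bracket x y);
  lts_skew : forall x y z, lts_bracket x y z = - lts_bracket y x z;
  lts_cyclic : forall x y z,
    lts_bracket x y z + lts_bracket y z x + lts_bracket z x y = 0;
  lts_derivation : forall x y z t e,
    lts_bracket x y (lts_bracket z t e) =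
      lts_bracket (lts_bracket x y z) t e + lts_bracket z (lts_bracket x y t) e
      + lts_bracket z t (lts_bracket x y e) }.
End LieTripleSystems.

(* The definitions of this section are formulated for additive groups and      *)
(* plain maps, so that they apply both over K and, with the coefficientwise    *)
(* operations below, over K[[t]].                                              *)
Section GenericOperators.
Variables (L V : zmodType) (br : L -> L -> L -> L) (th : L -> L -> V -> V).

Definition repD (x y : L) (u : V) : V := th y x u - th x y u.

Definition opBracket (T : V -> L) (u v w : V) : V :=
  repD (T u) (T v) w + th (T v) (T w) u - th (T u) (T w) v.

Definition O_identity (T : V -> L) (u v w : V) : Prop :=
  br (T u) (T v) (T w) = T (opBracket T u v w).

Definition O_morphism (T T' : V -> L) (phi : L -> L) (psi : V -> V) : Prop :=
  [/\ forall x y z, phi (br x y z) = br (phi x) (phi y) (phi z),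
      forall u, phi (T u) = T' (psi u)
    & forall x y u, psi (th x y u) = th (phi x) (phi y) (psi u)].
End GenericOperators.

Section Representations.
Variables (K : fieldType) (L : lmodType K) (br : lts L) (V : lmodType K).

Record lts_rep := LtsRep {
  rep_map :> L -> L -> V -> V;
  rep_linear1 : forall y u, linear (fun x => rep_map x y u);
  rep_linear2 : forall x u, linear (fun y => rep_map x y u);
  rep_linear3 : forall x y, linear (rep_map x y);
  rep_axiom1 : forall x y z t u,
    rep_map z t (rep_map x y u) - rep_map y t (rep_map x z u)
    - rep_map x (br y z t) u + repD rep_map y z (rep_map x t u) = 0;
  rep_axiom2 : forall x y z t u,
    rep_map z t (repD rep_map x y u) - repD rep_map x y (rep_map z t u)
    + rep_map (br x y z) t u + rep_map z (br x y t) u = 0 }.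
End Representations.

Section Cohomology.
Variables (K : fieldType) (L V : lmodType K) (br : lts L) (th : lts_rep br V).

Definition brX (X : ext2 L) (z : L) : L := ext2_lift (fun x y => br x y z) X.
Definition DX (X : ext2 L) (u : V) : V := ext2_lift (fun x y => repD th x y u) X.

Lemma lts_alternating z : [pchar K] =i pred0 ->
  alternating_bilinear (fun x y => br x y z).
Proof.
move=> hK; split=> [y | x | x].
- exact: lts_linear1.
- exact: lts_linear2.
have h2 : (2%:R : K) != 0.
  by apply/eqP => h; have := hK 2%N; rewrite !inE h eqxx.
have /eqP : 2%:R *: br x x z = 0.
  by rewrite scaler_nat mulr2n {1}lts_skew addNr.
by rewrite scaler_eq0 (negPf h2) /= => /eqP.
Qed.

Lemma repD_alternating u : alternating_bilinear (fun x y => repD th x y u).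
Proof.
split=> [y a x x' | x a y y' | x]; last by rewrite /repD subrr.
all: by rewrite /repD rep_linear1 rep_linear2 scalerBr opprD !addrA;
  congr (_ + _); rewrite -!addrA; congr (_ + _); rewrite addrC.
Qed.

Lemma brX_wedge x y z : [pchar K] =i pred0 -> brX (wedge x y) z = br x y z.
Proof.
by move=> hK; exact: (ext2_lift_wedge x y (lts_alternating z hK)).
Qed.

Lemma DX_wedge x y u : DX (wedge x y) u = repD th x y u.
Proof. exact: (ext2_lift_wedge x y (repD_alternating u)). Qed.

Variable T : V -> L.

Definition thT (u v : V) (x : L) : L :=
  br x (T u) (T v) + T (th x (T v) u - repD th x (T u) v).

Definition DT (u v : V) (x : L) : L := repD thT u v x.

Definition Z1 : set (V -> L) :=
  [set f | linear f /\ forall v1 v2 v3,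
     DT v1 v2 (f v3) - thT v1 v3 (f v2) + thT v2 v3 (f v1)
     - f (opBracket th T v1 v2 v3) = 0]%classic.

Definition dT (X : ext2 L) : V -> L := fun v => T (DX X v) - brX X (T v).

Definition Nij : set (ext2 L) :=
  [set X | [/\ forall z1 z2 z3,
                 br z1 (brX X z2) (brX X z3) + br (brX X z1) z2 (brX X z3)
                 + br (brX X z1) (brX X z2) z3 = 0,
               forall z1 z2 z3, br (brX X z1) (brX X z2) (brX X z3) = 0,
               forall z1 z2 u,
                 th z1 (brX X z2) (DX X u) + th (brX X z1) z2 (DX X u)
                 + th (brX X z1) (brX X z2) u = 0,
               forall z1 z2 u, th (brX X z1) (brX X z2) (DX X u) = 0
             & forall u, brX X (T (DX X u) - brX X (T u)) = 0]]%classic.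
End Cohomology.

(* A power series with coefficients in M is the sequence nat -> M of its       *)
(* coefficients, with pointwise addition.                                      *)
Section PowerSeries.

Definition fps_const (M : zmodType) (u : M) : nat -> M :=
  fun n => if n == 0%N then u else 0.

Definition fps3 (A B C : Type) (M : zmodType) (f : A -> B -> C -> M)
    (x : nat -> A) (y : nat -> B) (z : nat -> C) : nat -> M :=
  fun n => \sum_(i < n.+1) \sum_(j < (n - i).+1)
    f (x i) (y j) (z (n - i - j)%N).

(* the action of \sum_i F_i t^i on the power series x *)
Definition fps_app (A : Type) (M : zmodType) (F : nat -> A -> M)
    (x : nat -> A) : nat -> M :=
  fun n => \sum_(i < n.+1) F i (x (n - i)%N).
End PowerSeries.

Section Deformations.
Variables (K : fieldType) (L V : lmodType K) (br : lts L) (th : lts_rep br V).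

Definition formal_deformation (T : {linear V -> L})
    (Tt : nat -> {linear V -> L}) : Prop :=
  Tt 0%N =1 T /\
  forall u v w : V,
    O_identity (fps3 br) (fps3 th) (fps_app Tt)
      (fps_const u) (fps_const v) (fps_const w).

Definition equivalent_deformations (Tt Tt' : nat -> {linear V -> L}) : Prop :=
  exists (X : ext2 L) (phi : nat -> {linear L -> L}) (psi : nat -> {linear V -> V}),
    [/\ phi 0%N =1 id, phi 1%N =1 brX br X,
        psi 0%N =1 id, psi 1%N =1 DX th X
      & O_morphism (fps3 br) (fps3 th) (fps_app Tt) (fps_app Tt')
          (fps_app phi) (fps_app psi)].

Definition constant_deformation (T : {linear V -> L}) : nat -> {linear V -> L} :=
  fun n => if n == 0%N then T else (\0)%R : {linear V -> L}.

Definition trivial_deformation (T : {linear V -> L})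
    (Tt : nat -> {linear V -> L}) : Prop :=
  equivalent_deformations Tt (constant_deformation T).

Definition rigid (T : {linear V -> L}) : Prop :=
  forall Tt, formal_deformation T Tt -> trivial_deformation T Tt.

Definition O_operator (T : {linear V -> L}) : Prop :=
  forall u v w, O_identity br th T u v w.
End Deformations.

(* Main.v *)
Require Import Defs.
From HB Require Import structures.
From mathcomp Require Import all_boot all_order all_algebra.
From mathcomp Require Import boolp classical_sets functions.

Set Implicit Arguments.
Unset Strict Implicit.
Unset Printing Implicit Defensive.

Import GRing.Theory.
Local Open Scope ring_scope.

(** Write [phi], [psi], [Tt] for the maps that the coefficient series act by on
    power series.  The task is to find an automorphism pair (phi, psi) of (L; theta)
    over K[[t]], with first-order terms [X, -] and D(X) for a common X, such that
    phi Tt = T psi.  The pair is built one order at a time.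

    Suppose that an automorphism pair congruent to the identity modulo t satisfies
    phi Tt = T psi modulo t^n, with n > 0, and let f : V -> L be the coefficient of
    t^n in phi Tt - T psi on constants.  Since phi Tt commutes with t, f governs
    that coefficient on every series ([obstruction_lead]).  Apply phi to the
    O-operator identity of Tt: up to order n it is the identity of T at psi u,
    psi v, psi w, perturbed by t^n f, and the coefficient of t^n of the difference
    says that f is a 1-cocycle for T ([obstruction_cocycle]).  The map psi never has
    to be inverted, because the deformations phi Tt psi^-1 are not used themselves.

    By hypothesis f = d_T(X) with X a Nijenhuis element.  As [X, -] and D(X) are
    compatible derivations, and the Nijenhuis conditions are the vanishing of the
    terms of orders 2 and 3 in s of the morphism equations for 1 + s [X, -] and
    1 + s D(X), these two maps form an automorphism pair for every s, in particular
    for s = t^n ([fps3_unipotent]).  Composing with it adds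
    [X, T v] - T (D(X) v) = - f v to the coefficient of t^n, so the congruence
    improves to order n + 1 ([conjugating_step]).

    Since the n-th correction leaves the coefficients below n untouched, the pairs
    converge coefficientwise, and the coefficient of order n of each equation
    required of the limit only involves coefficients of order at most n
    ([formal_deformation_trivial]).  The first correction supplies the element X of
    the equivalence, because later ones do not change the coefficient of t. *)

(** * Multiplication of power series by powers of t *)

Section Delay.
Variables (M : Type) (z : M).

(** This is multiplication by t.  The filler [z] is explicit so that a series of
    bundled linear maps can be shifted in the same way, with the zero map as [z]. *)
Definition delay1 (x : nat -> M) : nat -> M :=
  fun k => if k is k'.+1 then x k' else z.

Definition delay n : (nat -> M) -> nat -> M := iter n delay1.

Lemma delayE n x k : delay n x k = if (k < n)%N then z else x (k - n)%N.
Proof.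
by elim: n k => [|n IHn] [|k] //=; rewrite IHn ltnS subSS.
Qed.

Lemma delay_lt n x k : (k < n)%N -> delay n x k = z.
Proof. by rewrite delayE => ->. Qed.

Lemma delay_diag n x : delay n x n = x 0%N.
Proof. by rewrite delayE ltnn subnn. Qed.

Lemma delay_delay m n x : delay m (delay n x) = delay (m + n) x.
Proof. by rewrite /delay iterD. Qed.

Lemma delay_drop n x : (forall k, (k < n)%N -> x k = z) ->
  x = delay n (fun k => x (n + k)%N).
Proof.
move=> x0; apply/funext => k; rewrite delayE; case: ltnP => [/x0 //|le_nk].
by rewrite subnKC.
Qed.
End Delay.

Lemma delayD (M : zmodType) n (x y : nat -> M) :
  delay 0 n (x + y) = delay 0 n x + delay 0 n y.
Proof.
by apply/funext => k; rewrite !fctE !delayE; case: ifP; rewrite ?addr0.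
Qed.

Lemma delay0 (M : zmodType) n : delay 0 n (0 : nat -> M) = 0.
Proof. by apply/funext => k; rewrite delayE; case: ifP. Qed.

Lemma fps_decomp (M : zmodType) (x : nat -> M) :
  x = fps_const (x 0%N) + delay 0 1 (x \o succn).
Proof. by apply/funext => -[|k] /=; rewrite fctE /= ?addr0 ?add0r. Qed.

(** * Trilinear products of power series *)

Section TrilinearProducts.
Variables (A B C M : zmodType).
Implicit Types f : A -> B -> C -> M.

(** Plain additivity is enough for products of power series; unlike linearity, it
    survives a permutation of the arguments without naming a ring of scalars. *)
Record triadditive f : Prop := Triadditive {
  triD1 : forall b c, {morph (fun a => f a b c) : a a' / a + a'};
  triD2 : forall a c, {morph (fun b => f a b c) : b b' / b + b'};
  triD3 : forall a b, {morph f a b : c c' / c + c'} }.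

Lemma fps3_trunc f x y z x' y' z' n :
    (forall k, (k <= n)%N -> x k = x' k) ->
    (forall k, (k <= n)%N -> y k = y' k) ->
    (forall k, (k <= n)%N -> z k = z' k) ->
  fps3 f x y z n = fps3 f x' y' z' n.
Proof.
move=> ex ey ez; apply: eq_bigr => i _; apply: eq_bigr => j _.
rewrite ex -1?ltnS // ey ?ez //.
  by rewrite -subnDA leq_subr.
by apply: leq_trans (leq_subr i n); rewrite -ltnS.
Qed.

Lemma eq_fps3 f g x y z :
  (forall a b c, f a b c = g a b c) -> fps3 f x y z = fps3 g x y z.
Proof.
by move=> efg; apply/funext => n; do 2!apply: eq_bigr => ? _; apply: efg.
Qed.

Lemma fps3_0 f x y z : fps3 f x y z 0 = f (x 0%N) (y 0%N) (z 0%N).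
Proof. by rewrite /fps3 !big_ord_recl !big_ord0 !addr0. Qed.

Lemma fps3_funD f g x y z :
  fps3 (fun a b c => f a b c + g a b c) x y z = fps3 f x y z + fps3 g x y z.
Proof.
apply/funext => n; rewrite fctE /fps3 -big_split; apply: eq_bigr => i _.
by rewrite -big_split.
Qed.

Lemma fps3_funN f x y z :
  fps3 (fun a b c => - f a b c) x y z = - fps3 f x y z.
Proof.
apply/funext => n; rewrite fctE /fps3 -sumrN; apply: eq_bigr => i _.
by rewrite -sumrN.
Qed.

Lemma fps3_fun0 x y z : fps3 (fun (_ : A) (_ : B) (_ : C) => 0 : M) x y z = 0.
Proof. by apply/funext => n; apply: big1 => i _; apply: big1. Qed.

Lemma fps3_comp (N : zmodType) f (h : M -> N) x y z :
    h 0 = 0 -> {morph h : u v / u + v} ->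
  h \o fps3 f x y z = fps3 (fun a b c => h (f a b c)) x y z.
Proof.
move=> h0 hD; apply/funext => n /=; rewrite /fps3 (big_morph h hD h0).
by apply: eq_bigr => i _; rewrite (big_morph h hD h0).
Qed.
End TrilinearProducts.

(** Permuting the factors reduces every statement on one slot of [fps3] to a
    statement on the first. *)
Lemma fps3_swap12 (A B C M : zmodType) (f : A -> B -> C -> M) x y z :
  fps3 f x y z = fps3 (fun b a c => f a b c) y x z.
Proof.
(* the bound i + j <= n is symmetric, unlike j <= n - i, so the sums commute *)
have triE (A' B' C' : zmodType) (g : A' -> B' -> C' -> M) a b c n :
    fps3 g a b c n = \sum_(i < n.+1) \sum_(j < n.+1)
      if (i + j <= n)%N then g (a i) (b j) (c (n - (i + j))%N) else 0.
  apply: eq_bigr => i _; have le_in : (i <= n)%N by rewrite -ltnS.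
  rewrite -big_mkcond (big_ord_widen_cond n.+1 xpredT
    (fun j => g (a i) (b j) (c (n - i - j)%N))) ?ltnS ?leq_subr //=.
  apply: eq_big => [j|j _]; last by rewrite subnDA.
  by rewrite ltnS leq_subRL.
apply/funext => n; rewrite !triE exchange_big; apply: eq_bigr => j _.
by apply: eq_bigr => i _; rewrite addnC.
Qed.

Lemma fps3_swap23 (A B C M : zmodType) (f : A -> B -> C -> M) x y z :
  fps3 f x y z = fps3 (fun a c b => f a b c) x z y.
Proof.
apply/funext => n; apply: eq_bigr => i _; rewrite (reindex_inj rev_ord_inj).
apply: eq_bigr => j _ /=; rewrite !subSS subKn //.
by rewrite -ltnS.
Qed.

Section TrilinearShift.
Variables (A B C M : zmodType) (f : A -> B -> C -> M).
Hypothesis fD : triadditive f.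

Lemma tri01 b c : f 0 b c = 0.
Proof. by apply: (@addrI _ (f 0 b c)); rewrite -(triD1 fD) !addr0. Qed.

Lemma triadditive_swap12 : triadditive (fun b a c => f a b c).
Proof. by case: fD => f1 f2 f3; split. Qed.

Lemma triadditive_swap23 : triadditive (fun a c b => f a b c).
Proof. by case: fD => f1 f2 f3; split. Qed.

Lemma fps3Dl x x' y z : fps3 f (x + x') y z = fps3 f x y z + fps3 f x' y z.
Proof.
apply/funext => n; rewrite /fps3 !fctE -big_split; apply: eq_bigr => i _.
by rewrite -big_split; apply: eq_bigr => j _; rewrite (triD1 fD).
Qed.

Lemma fps3_delayl m x y z :
  fps3 f (delay 0 m x) y z = delay 0 m (fps3 f x y z).
Proof.
elim: m x => [//|m IHm] x; rewrite /delay /= -/(delay 0 m x) -/(delay 0 m _).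
rewrite -IHm; apply/funext => n; rewrite /fps3 big_ord_recl.
rewrite big1 ?add0r => [|j _]; last exact: tri01.
by case: n => [|n] /=; [rewrite big_ord0|].
Qed.
End TrilinearShift.

Lemma tri02 (A B C M : zmodType) (f : A -> B -> C -> M) a c :
  triadditive f -> f a 0 c = 0.
Proof. by move=> /triadditive_swap12/tri01; apply. Qed.

Lemma tri03 (A B C M : zmodType) (f : A -> B -> C -> M) a b :
  triadditive f -> f a b 0 = 0.
Proof. by move=> /triadditive_swap23/tri02; apply. Qed.

Lemma fps3Dm (A B C M : zmodType) (f : A -> B -> C -> M) x y y' z :
  triadditive f -> fps3 f x (y + y') z = fps3 f x y z + fps3 f x y' z.
Proof.
move=> /triadditive_swap12 fD.
by rewrite fps3_swap12 fps3Dl // -!(fps3_swap12 f).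
Qed.

Lemma fps3Dr (A B C M : zmodType) (f : A -> B -> C -> M) x y z z' :
  triadditive f -> fps3 f x y (z + z') = fps3 f x y z + fps3 f x y z'.
Proof.
move=> /triadditive_swap23 fD.
by rewrite fps3_swap23 fps3Dm // -!(fps3_swap23 f).
Qed.

Lemma fps3_delaym (A B C M : zmodType) (f : A -> B -> C -> M) m x y z :
  triadditive f -> fps3 f x (delay 0 m y) z = delay 0 m (fps3 f x y z).
Proof.
move=> /triadditive_swap12 fD.
by rewrite fps3_swap12 fps3_delayl // -(fps3_swap12 f).
Qed.

Lemma fps3_delayr (A B C M : zmodType) (f : A -> B -> C -> M) m x y z :
  triadditive f -> fps3 f x y (delay 0 m z) = delay 0 m (fps3 f x y z).
Proof.
move=> /triadditive_swap23 fD.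
by rewrite fps3_swap23 fps3_delaym // -(fps3_swap23 f).
Qed.

Definition unipotent (M : zmodType) (n : nat) (h : M -> M) (x : nat -> M) :
  nat -> M := x + delay 0 n (h \o x).

(** With s = t^n, the two sides are polynomials of degree at most 3 in s: the first
    hypothesis on [f] compares the terms in s, the other two kill those in s^2 and
    s^3.  For [f] the bracket or the representation and the maps given by a
    Nijenhuis element, these are the derivation property and the Nijenhuis
    conditions. *)
Lemma fps3_unipotent (A B C M : zmodType) (f : A -> B -> C -> M)
    (al : A -> A) (be : B -> B) (ga : C -> C) (mu : M -> M) n x y z :
    triadditive f -> mu 0 = 0 -> {morph mu : u v / u + v} ->
    (forall a b c,
       mu (f a b c) = f (al a) b c + f a (be b) c + f a b (ga c)) ->
    (forall a b c,
       f (al a) (be b) c + f (al a) b (ga c) + f a (be b) (ga c) = 0) ->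
    (forall a b c, f (al a) (be b) (ga c) = 0) ->
  unipotent n mu (fps3 f x y z) =
    fps3 f (unipotent n al x) (unipotent n be y) (unipotent n ga z).
Proof.
move=> fD mu0 muD h1 h2 h3.
rewrite /unipotent !(fps3Dl fD, fps3Dm _ _ _ _ fD, fps3Dr _ _ _ _ fD).
rewrite !(fps3_delayl fD, fps3_delaym _ _ _ _ fD, fps3_delayr _ _ _ _ fD).
rewrite !delay_delay.
have -> : mu \o fps3 f x y z = fps3 f (al \o x) y z + fps3 f x (be \o y) z
    + fps3 f x y (ga \o z).
  rewrite fps3_comp // (eq_fps3 _ _ _ h1).
  by rewrite !fps3_funD.
have E2 : fps3 f (al \o x) (be \o y) z + fps3 f (al \o x) y (ga \o z)
    + fps3 f x (be \o y) (ga \o z) = 0.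
  transitivity (fps3 (fun a b c =>
    f (al a) (be b) c + f (al a) b (ga c) + f a (be b) (ga c)) x y z).
    by rewrite !fps3_funD.
  by rewrite (eq_fps3 _ _ _ h2) fps3_fun0.
have E3 : fps3 f (al \o x) (be \o y) (ga \o z) = 0.
  transitivity (fps3 (fun a b c => f (al a) (be b) (ga c)) x y z) => //.
  by rewrite (eq_fps3 _ _ _ h3) fps3_fun0.
rewrite E3 delay0 addr0 -[LHS]addr0 -(delay0 M (n + n)) -E2 !delayD.
by rewrite [RHS](AC ((2*2)*(2*1)) (1*(5*3*2)*(7*6*4))).
Qed.
(** As x - x' is divisible by t^n, at order n its leading coefficient only meets the
    constant terms of the other factors. *)
Lemma fps3_perturbl (A B C M : zmodType) (f : A -> B -> C -> M) n x x' y z :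
    triadditive f -> (forall k, (k < n)%N -> x k = x' k) ->
  fps3 f x y z n = fps3 f x' y z n + f (x n - x' n) (y 0%N) (z 0%N).
Proof.
move=> fD ex; have ex0 k : (k < n)%N -> (x - x') k = 0.
  by move=> /ex e; rewrite !fctE e subrr.
rewrite -{1}(subrKC x' x) fps3Dl // fctE (delay_drop ex0) fps3_delayl //.
by rewrite delay_diag fps3_0 addn0.
Qed.

(** When n > 0, products of two or three perturbations have order at least 2n and
    do not contribute. *)
Lemma fps3_perturb (A B C M : zmodType) (f : A -> B -> C -> M) n
    x x' y y' z z' : triadditive f -> (0 < n)%N ->
    (forall k, (k < n)%N -> x k = x' k) ->
    (forall k, (k < n)%N -> y k = y' k) ->
    (forall k, (k < n)%N -> z k = z' k) ->
  fps3 f x y z n = fps3 f x' y' z' n + f (x n - x' n) (y' 0%N) (z' 0%N)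
    + f (x' 0%N) (y n - y' n) (z' 0%N) + f (x' 0%N) (y' 0%N) (z n - z' n).
Proof.
move=> fD n0 ex ey ez; have fD12 := triadditive_swap12 fD.
have fD13 := triadditive_swap12 (triadditive_swap23 fD).
rewrite (fps3_perturbl y z fD ex) fps3_swap12 (fps3_perturbl x' z fD12 ey).
rewrite -(fps3_swap12 f) fps3_swap23 fps3_swap12.
rewrite (fps3_perturbl x' y' fD13 ez) -(fps3_swap12 (fun a c b => f a b c)).
rewrite -(fps3_swap23 f) -(ey _ n0) -(ez _ n0).
by rewrite [LHS](ACl (1*4*3*2)).
Qed.

(** * Power series of linear maps *)

Section SeriesOfMaps.
Variables (K : fieldType) (A M : lmodType K).
Implicit Types (F G : nat -> {linear A -> M}) (x y : nat -> A).

Lemma fps_app_trunc F G x y n :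
    (forall k, (k <= n)%N -> F k =1 G k) -> (forall k, (k <= n)%N -> x k = y k) ->
  fps_app F x n = fps_app G y n.
Proof.
move=> eFG exy; apply: eq_bigr => i _.
by rewrite exy ?leq_subr // eFG // -ltnS.
Qed.

Lemma fps_app0 F x : fps_app F x 0 = F 0%N (x 0%N).
Proof. by rewrite /fps_app big_ord_recl big_ord0 addr0. Qed.

Lemma fps_app_const F u n : fps_app F (fps_const u) n = F n u.
Proof.
rewrite /fps_app big_ord_recr /= subnn /fps_const eqxx big1 ?add0r // => i _.
by rewrite subn_eq0 leqNgt ltn_ord linear0.
Qed.

Lemma fps_appD F x y : fps_app F (x + y) = fps_app F x + fps_app F y.
Proof.
apply/funext => n; rewrite /fps_app !fctE -big_split; apply: eq_bigr => i _.
by rewrite linearD.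
Qed.

Lemma fps_appN F x : fps_app F (- x) = - fps_app F x.
Proof.
apply/funext => n; rewrite /fps_app !fctE -sumrN; apply: eq_bigr => i _.
by rewrite linearN.
Qed.

Lemma fps_app_delay1 F x : fps_app F (delay 0 1 x) = delay 0 1 (fps_app F x).
Proof.
apply/funext => -[|n]; first by rewrite fps_app0 linear0.
rewrite /fps_app big_ord_recr /= subnn linear0 addr0; apply: eq_bigr => i _.
by rewrite subSn // -ltnS.
Qed.

Lemma fps_app_funD F G x :
  fps_app (fun k => F k \+ G k : {linear A -> M}) x = fps_app F x + fps_app G x.
Proof. by apply/funext => n; rewrite /fps_app !fctE -big_split. Qed.

Lemma fps_app_delay_fun n F x :
  fps_app (delay (\0 : {linear A -> M}) n F) x = delay 0 n (fps_app F x).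
Proof.
elim: n => [//|n IHn]; rewrite /delay /= -/(delay _ n F) -/(delay 0 n _) -IHn.
apply/funext => k; rewrite /fps_app big_ord_recl /= add0r.
by case: k => [|k]; rewrite ?big_ord0.
Qed.
End SeriesOfMaps.

Lemma fps_app_constant (K : fieldType) (L V : lmodType K) (T : {linear V -> L}) x :
  fps_app (constant_deformation T) x = T \o x.
Proof.
by apply/funext => n; rewrite /fps_app big_ord_recl subn0 big1 ?addr0.
Qed.

Lemma fps_app_comp (K : fieldType) (A M N : lmodType K)
    (h : {linear M -> N}) (F : nat -> {linear A -> M}) x :
  fps_app (fun k => h \o F k : {linear A -> N}) x = h \o fps_app F x.
Proof. by apply/funext => n; rewrite /fps_app /= linear_sum. Qed.

Section UnipotentStep.
Variables (K : fieldType) (M : lmodType K).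

(** The coefficients of the composite of 1 + t^n h with the series F; see
    [fps_app_unipotent]. *)
Definition unipotent_step n (h : {linear M -> M}) (F : nat -> {linear M -> M})
    : nat -> {linear M -> M} :=
  fun k => F k \+ delay (\0 : {linear M -> M}) n
             (fun k => h \o F k : {linear M -> M}) k : {linear M -> M}.

Lemma fps_app_unipotent n h F x :
  fps_app (unipotent_step n h F) x = unipotent n h (fps_app F x).
Proof. by rewrite fps_app_funD fps_app_delay_fun fps_app_comp. Qed.

Lemma unipotent_step_lt n h F k : (k < n)%N -> unipotent_step n h F k =1 F k.
Proof. by move=> lt_kn u; rewrite /unipotent_step delay_lt //= addr0. Qed.

Lemma unipotent_step_diag n h F u :
  unipotent_step n h F n u = F n u + h (F 0%N u).
Proof. by rewrite /unipotent_step delay_diag. Qed.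
End UnipotentStep.

(** * The action of the exterior square *)

Section ExteriorAction.
Variables (K : fieldType) (L V : lmodType K) (br : lts L) (th : lts_rep br V).

Lemma linear_additive (U W : lmodType K) (h : U -> W) :
  linear h -> {morph h : u v / u + v}.
Proof. by move=> hl u v; have := hl 1 u v; rewrite !scale1r. Qed.

Lemma lts_triadditive : triadditive br.
Proof.
split=> [b c|a c|a b]; apply: linear_additive.
- exact: lts_linear1.
- exact: lts_linear2.
- exact: lts_linear3.
Qed.

Lemma rep_triadditive : triadditive th.
Proof.
split=> [b c|a c|a b]; apply: linear_additive.
- exact: rep_linear1.
- exact: rep_linear2.
- exact: rep_linear3.
Qed.

Fact brX_linear X : linear (brX br X).
Proof.
move=> a x y; rewrite /brX /ext2_lift /eval_pairs scaler_sumr -big_split.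
by apply: eq_bigr => p _; rewrite lts_linear3.
Qed.

Fact DX_linear X : linear (DX th X).
Proof.
move=> a x y; rewrite /DX /ext2_lift /eval_pairs scaler_sumr -big_split.
apply: eq_bigr => p _; rewrite /repD !rep_linear3 scalerBr opprD /=.
by rewrite [LHS](AC (2*2) ((1*3)*(2*4))).
Qed.

HB.instance Definition _ X :=
  GRing.isLinear.Build K L L *:%R (brX br X) (brX_linear X).
HB.instance Definition _ X :=
  GRing.isLinear.Build K V V *:%R (DX th X) (DX_linear X).

(** Each summand x /\ y acts by a derivation, by the fundamental identity. *)
Lemma brX_derivation X z t e :
  brX br X (br z t e) =
    br (brX br X z) t e + br z (brX br X t) e + br z t (brX br X e).
Proof.
have [b1 b2 b3] := lts_triadditive.
have b01 b c := tri01 lts_triadditive b c.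
have b02 a c := tri02 a c lts_triadditive.
have b03 a b := tri03 a b lts_triadditive.
rewrite /brX /ext2_lift /eval_pairs; elim: (repr X) => [|p s IHs].
  by rewrite !big_nil b01 b02 b03 !addr0.
rewrite !big_cons IHs b1 b2 b3 lts_derivation.
by rewrite [LHS](AC (3*3) ((1*4)*(2*5)*(3*6))).
Qed.

(** The second axiom of representations, summed over the wedges that make up X. *)
Lemma DX_derivation X z t u :
  DX th X (th z t u) =
    th (brX br X z) t u + th z (brX br X t) u + th z t (DX th X u).
Proof.
have [b1 b2 b3] := rep_triadditive.
have b01 b c := tri01 rep_triadditive b c.
have b02 a c := tri02 a c rep_triadditive.
have b03 a b := tri03 a b rep_triadditive.
rewrite /DX /brX /ext2_lift /eval_pairs; elim: (repr X) => [|p s IHs].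
  by rewrite !big_nil b01 b02 b03 !addr0.
rewrite !big_cons IHs b1 b2 b3.
rewrite [RHS](AC ((2*2)*2) ((1*3*5)*(2*4*6))); congr (_ + _).
apply/esym/subr0_eq; apply: etrans (rep_axiom2 th p.1 p.2 z t u).
by rewrite [LHS](AC (3*1) (3*4*1*2)).
Qed.
End ExteriorAction.

(** * Formal deformations *)

Section Deformation.
Variables (K : fieldType) (L V : lmodType K) (br : lts L) (th : lts_rep br V).
Variables (T : {linear V -> L}) (hT : O_operator th T).

(** The expression inside T in the O-operator identity, with the images under the
    operator as separate arguments: after applying an automorphism pair these are
    no longer the images of u, v, w under T. *)
Definition O_form (A B : zmodType) (f : A -> A -> B -> B) (a b c : A)
    (u v w : B) : B := repD f a b w + f b c u - f a c v.

(** Extended coefficientwise, T is an O-operator over K[[t]], on all series. *)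
Lemma O_operator_fps x y z :
  fps3 br (T \o x) (T \o y) (T \o z) =
    T \o O_form (fps3 th) (T \o x) (T \o y) (T \o z) x y z.
Proof.
have -> : O_form (fps3 th) (T \o x) (T \o y) (T \o z) x y z =
    fps3 (opBracket th T) x y z.
  rewrite /O_form /repD (fps3_swap12 th (T \o y) (T \o x)).
  rewrite (fps3_swap23 th (T \o x) (T \o z)).
  rewrite (fps3_swap23 th (T \o y)) (fps3_swap12 _ (T \o y)).
  transitivity (fps3 (fun a b c => th (T b) (T a) c - th (T a) (T b) c
    + th (T b) (T c) a - th (T a) (T c) b) x y z) => //.
  by rewrite !(fps3_funD, fps3_funN).
rewrite fps3_comp ?linear0 //; last exact: linearD.
by transitivity (fps3 (fun a b c => br (T a) (T b) (T c)) x y z);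
  last exact: eq_fps3.
Qed.

(** The part of D_T that involves brackets reduces to one bracket by the cyclic
    identity, and four of the six theta terms cancel. *)
Lemma DT_swap u v x :
  DT th T u v x = br (T u) (T v) x + T (th (T u) x v - th (T v) x u).
Proof.
rewrite /DT /thT /repD (opprD (br _ _ _)) addrACA -raddfB; congr (_ + T _).
  apply/subr0_eq; apply: etrans (lts_cyclic br x (T v) (T u)).
  by rewrite (lts_skew br (T v)) (lts_skew br (T u) x) [LHS]addrAC.
rewrite !opprB opprD opprB.
rewrite [LHS](AC ((1*2)*(1*2)) ((5*3)*((1*6)*(2*4)))) /=.
by rewrite !subrr !addr0.
Qed.

(** The hypothesis is the derivative of the O-operator identity at T in a direction
    that maps u, v, w to x, y, z and the bracket of u, v, w to c. *)
Lemma cocycle_of_linearization u v w (x y z c : L) :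
    br x (T v) (T w) + br (T u) y (T w) + br (T u) (T v) z =
      T (th y (T u) w + th (T v) x w - (th x (T v) w + th (T u) y w)
         + (th y (T w) u + th (T v) z u) - (th x (T w) v + th (T u) z v)) + c ->
  DT th T u v z - thT th T u w y + thT th T v w x - c = 0.
Proof.
have regroup (M : zmodType) (a b e d g f h k : M) :
    a + b - (e + d) + (g + f) - (h + k) =
      g - (d - a) - (k - f + (h - (b - e))).
  rewrite !(opprD, opprK).
  by rewrite [RHS](AC ((1*2)*(2*(1*2))) (((3*7)*(8*2))*(1*5)*(6*4))).
have move_terms (M : zmodType) (b1 b2 b3 p q r : M) :
    b3 + p - (- b2 + q) + (b1 + r) = b1 + b2 + b3 - (q - (p + r)).
  rewrite !(opprD, opprK).
  by rewrite [LHS](AC (2*2*2) ((5*3*1)*(4*(2*6)))).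
rewrite regroup DT_swap /thT /repD (lts_skew br y) => H.
by apply/eqP; rewrite subr_eq0 move_terms -raddfD -raddfB H addrC addKr.
Qed.

Variables (Tt : nat -> {linear V -> L}) (hTt : formal_deformation th T Tt).

(** The automorphism pair carries Tt to T modulo t^n.  The congruence ranges over
    all series x and not just constants, as the series to which Tt is applied in
    the O-operator identity is not constant. *)
Record conjugating_mod (n : nat) (phi : nat -> {linear L -> L})
    (psi : nat -> {linear V -> V}) : Prop := ConjugatingMod {
  conj_phi0 : phi 0%N =1 id;
  conj_psi0 : psi 0%N =1 id;
  conj_br : forall x y z, fps_app phi (fps3 br x y z) =
    fps3 br (fps_app phi x) (fps_app phi y) (fps_app phi z);
  conj_th : forall x y u, fps_app psi (fps3 th x y u) =
    fps3 th (fps_app phi x) (fps_app phi y) (fps_app psi u);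
  conj_lt : forall x k, (k < n)%N ->
    fps_app phi (fps_app Tt x) k = T (fps_app psi x k) }.

Section Obstruction.
Variables (n : nat) (phi : nat -> {linear L -> L}) (psi : nat -> {linear V -> V}).
Hypotheses (n_gt0 : (0 < n)%N) (hconj : conjugating_mod n phi psi).

Definition obstruction (v : V) : L :=
  fps_app phi (fps_app Tt (fps_const v)) n - T (psi n v).

(** The maps phi Tt and T psi commute with t and agree below order n, so that at
    order n only the constant term of x can make a difference. *)
Lemma obstruction_lead x :
  fps_app phi (fps_app Tt x) n = T (fps_app psi x n) + obstruction (x 0%N).
Proof.
rewrite {1 2}(fps_decomp x) !fps_appD !fctE !fps_app_delay1 raddfD.
rewrite /obstruction fps_app_const.
have -> : delay 0 1 (fps_app phi (fps_app Tt (x \o succn))) n =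
    T (delay 0 1 (fps_app psi (x \o succn)) n).
  by case: n n_gt0 (conj_lt hconj) => // m _ /(_ (x \o succn) m (ltnSn m)).
by rewrite [RHS]addrAC subrKC.
Qed.

Fact obstruction_linear : linear obstruction.
Proof.
have E v : obstruction v = (\sum_(i < n.+1) phi i (Tt (n - i)%N v)) - T (psi n v).
  by congr (_ - _); apply: eq_bigr => i _; rewrite fps_app_const.
move=> a u v; rewrite !E; under eq_bigr do rewrite !linearP.
rewrite big_split -scaler_sumr !linearP /= scalerBr ?scalerN.
by rewrite [LHS](AC (2*2) ((1*3)*(2*4))).
Qed.

(** Compare coefficients of t^n after applying phi to the identity of Tt on
    constants: the zeroth-order part is the identity of T at psi u, psi v, psi w,
    and what remains is the linearized identity in the direction [obstruction]. *)
Lemma obstruction_cocycle : Z1 th T obstruction.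
Proof.
split=> [|u v w]; first exact: obstruction_linear.
set U := fps_const u; set V' := fps_const v; set W := fps_const w.
have [phi0 psi0 cbr cth clt] := hconj; have [Tt0 /(_ u v w) def] := hTt.
have /(congr1 (fun s => fps_app phi s n)) := def.
rewrite cbr obstruction_lead.
have -> : fps_app psi (opBracket (fps3 th) (fps_app Tt) U V' W) =
    O_form (fps3 th) (fps_app phi (fps_app Tt U)) (fps_app phi (fps_app Tt V'))
      (fps_app phi (fps_app Tt W)) (fps_app psi U) (fps_app psi V') (fps_app psi W).
  by rewrite /opBracket /O_form /repD !(fps_appD, fps_appN) !cth.
have -> : opBracket (fps3 th) (fps_app Tt) U V' W 0%N = opBracket th T u v w.
  by rewrite /opBracket /repD !fctE !fps3_0 !fps_app_const !Tt0.
have ob0 z : T (fps_app psi (fps_const z) 0%N) = T z.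
  by rewrite fps_app_const psi0.
have obE z : fps_app phi (fps_app Tt (fps_const z)) n -
    (T \o fps_app psi (fps_const z)) n = obstruction z.
  by rewrite /= fps_app_const.
have lt z k : (k < n)%N -> fps_app phi (fps_app Tt (fps_const z)) k =
    (T \o fps_app psi (fps_const z)) k by move=> /clt ->.
rewrite /O_form /repD !fctE.
rewrite (fps3_perturb (lts_triadditive br) n_gt0 (lt u) (lt v) (lt w)).
(* the third factor is the same on both sides, so only two slots are perturbed *)
have perturb_th a b c : fps3 th (fps_app phi (fps_app Tt (fps_const a)))
    (fps_app phi (fps_app Tt (fps_const b))) (fps_app psi (fps_const c)) n =
    fps3 th (T \o fps_app psi (fps_const a)) (T \o fps_app psi (fps_const b))
      (fps_app psi (fps_const c)) n +
    (th (obstruction a) (T b) c + th (T a) (obstruction b) c).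
  rewrite (fps3_perturbl _ _ (rep_triadditive th) (lt a)).
  rewrite fps3_swap12.
  rewrite (fps3_perturbl _ _ (triadditive_swap12 (rep_triadditive th)) (lt b)).
  rewrite -(fps3_swap12 th) !obE /= !fps_app0 phi0 Tt0 !psi0.
  by rewrite -addrA; congr (_ + _); rewrite addrC.
rewrite !perturb_th !obE O_operator_fps /O_form /repD !fctE /= !ob0.
move=> H; apply: cocycle_of_linearization; move: H.
have split_perturbation (M : zmodType) (a b c d a' b' c' d' : M) :
    a + a' - (b + b') + (c + c') - (d + d') =
      (a - b + c - d) + (a' - b' + c' - d').
  by rewrite !opprD [LHS](AC (2*2*2*2) ((1*3*5*7)*(2*4*6*8))).
have cancel_T P E b1 b2 b3 c :
    T P + b1 + b2 + b3 = T (P + E) + c -> b1 + b2 + b3 = T E + c.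
  by rewrite raddfD -!addrA => /addrI.
by rewrite split_perturbation => /cancel_T.
Qed.
End Obstruction.

(** The corrections 1 + t^n [X, -] and 1 + t^n D(X) preserve the automorphism
    property and change the coefficient of t^n in phi Tt - T psi by - d_T(X). *)
Lemma conjugating_step n phi psi X :
    (0 < n)%N -> conjugating_mod n phi psi -> Nij th T X ->
    (forall v, obstruction n phi psi v = dT th T X v) ->
  conjugating_mod n.+1 (unipotent_step n (brX br X) phi)
    (unipotent_step n (DX th X) psi).
Proof.
move=> n_gt0 hconj [br2 br3 th2 th3 _] obX.
have lead := obstruction_lead n_gt0 hconj.
have [phi0 psi0 cbr cth clt] := hconj; split.
- by move=> u; rewrite unipotent_step_lt.
- by move=> u; rewrite unipotent_step_lt.
- move=> x y z; rewrite !fps_app_unipotent cbr.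
  apply: fps3_unipotent; rewrite ?linear0 //.
  + exact: lts_triadditive.
  + exact: linearD.
  + exact: brX_derivation.
  + by move=> a b c; rewrite -(br2 a b c) [LHS]addrC [RHS]addrAC -addrA addrC.
- move=> x y u; rewrite !fps_app_unipotent cth.
  apply: fps3_unipotent; rewrite ?linear0 //.
  + exact: rep_triadditive.
  + exact: linearD.
  + exact: DX_derivation.
  + by move=> a b c; rewrite -(th2 a b c) [LHS]addrC [RHS]addrAC -addrA addrC.
move=> x k; rewrite ltnS !fps_app_unipotent /unipotent !fctE raddfD => le_kn.
have [lt_kn|le_nk] := ltnP k n.
  by rewrite !(delay_lt _ _ lt_kn) raddf0 !addr0 clt.
have -> : k = n by apply/eqP; rewrite eqn_leq le_kn.
rewrite !delay_diag /= lead obX /dT !fps_app0 phi0 psi0 (proj1 hTt).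
by rewrite -addrA subrK.
Qed.

Definition id_series (M : lmodType K) : nat -> {linear M -> M} :=
  fun k => if k is 0%N then idfun : {linear M -> M} else \0 : {linear M -> M}.

Lemma fps_app_id (M : lmodType K) x : fps_app (id_series M) x = x.
Proof.
by apply/funext => n; rewrite /fps_app big_ord_recl subn0 big1 ?addr0.
Qed.

Lemma conjugating_id : conjugating_mod 1 (id_series L) (id_series V).
Proof.
split=> // [x y z|x y u|x [|//] _]; rewrite ?fps_app_id //.
by rewrite fps_app0 (proj1 hTt).
Qed.

Definition corrector n phi psi : ext2 L :=
  xget 0 [set X | Nij th T X /\
                  forall v, obstruction n phi psi v = dT th T X v]%classic.

(** Correcting order by order; the pair of index n is accurate modulo t^(n+1). *)
Fixpoint conjugators n : (nat -> {linear L -> L}) * (nat -> {linear V -> V}) :=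
  if n is m.+1 then
    let: (phi, psi) := conjugators m in
    let X := corrector n phi psi in
    (unipotent_step n (brX br X) phi, unipotent_step n (DX th X) psi)
  else (id_series L, id_series V).

Lemma conjugators_stable m n k : (k <= m <= n)%N ->
  (conjugators m).1 k =1 (conjugators n).1 k /\
  (conjugators m).2 k =1 (conjugators n).2 k.
Proof.
case/andP=> le_km; elim: n => [|n IHn]; first by rewrite leqn0 => /eqP ->.
rewrite leq_eqVlt => /predU1P[-> //|]; rewrite ltnS => le_mn.
have [e1 e2] := IHn le_mn; have lt_k : (k < n.+1)%N by apply: leq_trans le_mn.
move=> {IHn} /=; case: (conjugators n) e1 e2 => phi psi e1 e2.
by split=> u; rewrite ?e1 ?e2; apply/esym/unipotent_step_lt.
Qed.

Hypothesis hZ : (Z1 th T `<=` dT th T @` Nij th T)%classic.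

Lemma conjugators_conjugating n :
  conjugating_mod n.+1 (conjugators n).1 (conjugators n).2.
Proof.
elim: n => [|n] /=; first exact: conjugating_id.
case: (conjugators n) => phi psi /= hconj.
have [X NX dX] := hZ (obstruction_cocycle (ltn0Sn n) hconj).
have [|NX' dX'] := @xgetPex _ 0 [set X | Nij th T X /\
    forall v, obstruction n.+1 phi psi v = dT th T X v]%classic.
  by exists X; split=> // v; rewrite dX.
exact: conjugating_step.
Qed.

Lemma formal_deformation_trivial : trivial_deformation th T Tt.
Proof.
(* the diagonal sequence: coefficient k is final from the pair of index k on *)
pose phi k := (conjugators k).1 k; pose psi k := (conjugators k).2 k.
have phiE n k : (k <= n)%N -> phi k =1 (conjugators n).1 k.
  by move=> le_kn; case: (@conjugators_stable k n k); rewrite ?leqnn.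
have psiE n k : (k <= n)%N -> psi k =1 (conjugators n).2 k.
  by move=> le_kn; case: (@conjugators_stable k n k); rewrite ?leqnn.
have PhiE n x k : (k <= n)%N -> fps_app phi x k = fps_app (conjugators n).1 x k.
  by move=> le_kn; apply: fps_app_trunc => // j /leq_trans/(_ le_kn)/phiE.
have PsiE n x k : (k <= n)%N -> fps_app psi x k = fps_app (conjugators n).2 x k.
  by move=> le_kn; apply: fps_app_trunc => // j /leq_trans/(_ le_kn)/psiE.
exists (corrector 1 (id_series L) (id_series V)), phi, psi; split=> //.
- by move=> u; rewrite -[RHS]add0r; apply: unipotent_step_diag.
- by move=> u; rewrite -[RHS]add0r; apply: unipotent_step_diag.
split=> [x y z|x|x y u]; apply/funext => n.
- rewrite (PhiE n) // (conj_br (conjugators_conjugating n)).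
  by apply: fps3_trunc => k /PhiE.
- rewrite (PhiE n) // (conj_lt (conjugators_conjugating n)) // -(PsiE n) //.
  by rewrite fps_app_constant.
- rewrite (PsiE n) // (conj_th (conjugators_conjugating n)).
  by apply: fps3_trunc => k; [move=> /PhiE|move=> /PhiE|move=> /PsiE].
Qed.
End Deformation.

Theorem theorem5p5 (K : fieldType) (hK : [pchar K]%R =i pred0)
    (L V : lmodType K) (br : lts L) (th : lts_rep br V)
    (T : {linear V -> L}) (hT : O_operator th T)
    (hZ : Z1 th T = (dT th T @` Nij th T)%classic) :
  rigid th T.
Proof.
by move=> Tt hTt; apply: formal_deformation_trivial => //; rewrite hZ.
Qed.
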